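(* Let $p$ be an odd prime and let $P_r(x)\in\mathbb Z[\tfrac12][x]$ be the $r$-th Legendre polynomial. Then the following congruences of polynomials in $x$ hold modulo $p$: (1) $\displaystyle\sum_{r=0}^{p-1}P_r(x)\equiv\left(\frac{-2}{p}\right)(x-1)^{(p-1)/2} \mod p$; (2) $\displaystyle\sum_{r=0}^{p-1}P_r(x)^2\equiv(x^2-1)^{(p-1)/2} \mod p$.
   Context: The Legendre polynomials are defined by $P_0(x)=1$, $P_1(x)=x$, $(r+1)P_{r+1}(x)=(2r+1)xP_r(x)-rP_{r-1}(x)$; their coefficients lie in $\mathbb Z[\frac12]$, so they can be reduced modulo the odd prime $p$. $\left(\frac{\cdot}{p}\right)$ is the Legendre symbol. *)

(* Defs.v *)
From HB Require Import structures.
From mathcomp Require Import all_boot all_order all_algebra.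
Set Implicit Arguments. Unset Strict Implicit. Unset Printing Implicit Defensive.
Import Order.TTheory GRing.Theory Num.Theory.
Local Open Scope ring_scope.

(* With m = r.+1, the last branch is the recurrence
   (m + 1) P_{m+1} = (2 m + 1) x P_m - m P_{m-1}, solved for P_{m+1}. *)
Fixpoint legendre_poly (n : nat) : {poly rat} :=
  match n with
  | 0 => 1
  | m.+1 =>
    match m with
    | 0 => 'X
    | r.+1 => m.+1%:R^-1 *:
        ((2 * m + 1)%:R *: ('X * legendre_poly m) - m%:R *: legendre_poly r)
    end
  end.

(* The subring Z[1/2] of rat. *)
Definition in_Zhalf (c : rat) : Prop :=
  exists (k : nat) (m : int), c = m%:~R / 2%:R ^+ k.

(* Congruence modulo p in Z[1/2][x]: both sides lie in Z[1/2][x], and their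
   difference lies in p Z[1/2][x]. *)
Definition poly_Zhalf (f : {poly rat}) : Prop := forall i : nat, in_Zhalf f`_i.

Definition poly_congr (p : nat) (f g : {poly rat}) : Prop :=
  [/\ poly_Zhalf f, poly_Zhalf g &
      exists2 h : {poly rat}, poly_Zhalf h & f - g = p%:R *: h].

(* The Legendre symbol (a / p); only meaningful for p an odd prime. *)
Definition legendre_symbol (a : int) (p : nat) : int :=
  if a%:~R == 0 :> 'F_p then 0
  else if [exists x : 'F_p, x ^+ 2 == a%:~R] then 1
  else -1.

(* Main.v *)
Require Import Defs.
From HB Require Import structures.
From mathcomp Require Import all_boot all_order all_algebra.
From mathcomp Require Import cyclic finfield zify ring.
Set Implicit Arguments. Unset Strict Implicit. Unset Printing Implicit Defensive.
Import Order.TTheory GRing.Theory Num.Theory.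
Local Open Scope ring_scope.

(** Put v = (x - 1) / 2, u = (x^2 - 1) / 4 and
    a(r, k) = 'C(r + k, 2k) 'C(2k, k).  Both sums are controlled by expansions
    of the same shape with integer coefficients:

      P_r   = sum_k a(r, k) v^k,
      P_r^2 = sum_k a(r, k) 'C(2k, k) u^k.

    The first is the classical expansion at x = 1; the second is an instance of
    Clausen's formula for the square of a hypergeometric series.  Summing over
    r < p replaces a(r, k) by A_k = 'C(p + k, 2k + 1) 'C(2k, k), by the
    hockey-stick identity.  With h = (p - 1) / 2, the prime p divides A_k for
    every k < p other than k = h: the first binomial is divisible by p when
    k < h, the second when k > h.  And A_h = 'C(p + h, p) 'C(p - 1, h), which is
    (-1)^h modulo p.  So only the term of degree h survives, and the sums are
    congruent to (-1)^h v^h and (-1)^h 'C(p - 1, h) u^h, hence to u^h for the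
    second one.  Since 4^h = 2^(p - 1) is 1 modulo p, u^h becomes (x^2 - 1)^h and
    (-1)^h v^h becomes (-2)^h (x - 1)^h, where Euler's criterion identifies (-2)^h
    with the Legendre symbol.

    Both expansions follow from the three-term recurrence.  For the squares,
    induction needs the product of two consecutive polynomials as well, and the
    one fact to be found is its closed form

      r P_r P_(r-1) = x sum_k (r - k) a(r, k) 'C(2k, k) u^k.

    With it, the squared recurrence becomes an identity of rational functions
    in r and k.  The polynomials [shift_poly r], [sqr_poly r] and
    [cross_poly r] below are the three sums over k, written in a free
    variable for which v or u is substituted; [legendre_shiftE] and
    [legendre_sqr] are the two expansions, [Fp_leg_coef_sum] evaluates A_k
    modulo p, and [poly_congr_leg_coef_sum] deduces the congruence common to
    both parts. *)

(** * The expansion coefficients *)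

(** The factor n - m is taken in the rationals, where it may be negative; the
    identity survives because both binomials vanish for n < m. *)
Lemma rat_binSr n m :
  'C(n, m.+1)%:R = (n%:R - m%:R) * 'C(n, m)%:R / m.+1%:R :> rat.
Proof.
apply: canRL (mulfK _) _; first by rewrite pnatr_eq0.
rewrite mulrC -natrM mul_bin_left natrM.
have [le_mn | lt_nm] := leqP m n; first by rewrite natrB.
by rewrite bin_small // !mulr0.
Qed.

Lemma rat_binSS n m :
  'C(n.+1, m.+1)%:R = n.+1%:R * 'C(n, m)%:R / m.+1%:R :> rat.
Proof.
apply: canRL (mulfK _) _; first by rewrite pnatr_eq0.
by rewrite mulrC -!natrM -mul_bin_diag.
Qed.

Definition leg_coef n k : nat := 'C(n + k, k.*2) * 'C(k.*2, k).

Definition sqr_coef n k : nat := leg_coef n k * 'C(k.*2, k).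

Lemma rat_central_binS k :
  'C(k.+1.*2, k.+1)%:R
    = 2%:R * (2%:R * k%:R + 1) * 'C(k.*2, k)%:R / (k%:R + 1) :> rat.
Proof.
have k1 : k%:R + 1 != 0 :> rat by rewrite natr1 pnatr_eq0.
have -> : 'C(k.+1.*2, k.+1)%:R = 2%:R * 'C(k.*2.+1, k)%:R :> rat.
  rewrite doubleS rat_binSS -!natr1 -muln2 natrM; field.
  by rewrite natr1 pnatr_eq0.
have -> : 'C(k.*2.+1, k)%:R
    = (2%:R * k%:R + 1) * 'C(k.*2, k)%:R / (k%:R + 1) :> rat.
  apply: canRL (mulfK _) _ => //.
  have := mul_bin_down k.*2.+1 k; rewrite /=.
  move=> /(congr1 (GRing.natmul (1 : rat))).
  rewrite (_ : (k.*2.+1 - k = k.+1)%N); last lia.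
  by rewrite !natrM -!natr1 -muln2 natrM => e; rewrite mulrC -e; ring.
by field.
Qed.

Lemma leg_coef0 n : leg_coef n 0 = 1%N.
Proof. by rewrite /leg_coef !bin0. Qed.

Lemma leg_coef_small n k : (n < k)%N -> leg_coef n k = 0%N.
Proof. by move=> lt_nk; rewrite /leg_coef bin_small //; lia. Qed.

(** This lemma and the next two express a(n+2, k+1), a(n+1, k+1) and a(n, k+1)
    as rational multiples of the single number a(n+1, k), so that any linear
    relation among them reduces to an identity of rational functions. *)
Lemma leg_coefSS n k :
  (leg_coef n.+2 k.+1)%:R
    = (n%:R + k%:R + 3%:R) * (n%:R + k%:R + 2%:R) / (k%:R + 1) ^+ 2
      * (leg_coef n.+1 k)%:R :> rat.
Proof.
rewrite /leg_coef (_ : n.+2 + k.+1 = (n + k).+3)%N ?addSn; last lia.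
rewrite !natrM rat_central_binS doubleS !rat_binSS -!natr1 natrD -muln2 natrM.
by field; rewrite !(natr1, =^~ natrM, =^~ natrD) !pnatr_eq0; lia.
Qed.

Lemma leg_coefSm n k :
  (leg_coef n.+1 k.+1)%:R
    = (n%:R + k%:R + 2%:R) * (n%:R + 1 - k%:R) / (k%:R + 1) ^+ 2
      * (leg_coef n.+1 k)%:R :> rat.
Proof.
rewrite /leg_coef (_ : n.+1 + k.+1 = (n + k).+2)%N ?addSn; last lia.
rewrite !natrM rat_central_binS doubleS rat_binSS rat_binSr.
rewrite -!natr1 natrD -muln2 natrM.
by field; rewrite !(natr1, =^~ natrM, =^~ natrD) !pnatr_eq0; lia.
Qed.

Lemma leg_coefmm n k :
  (leg_coef n k.+1)%:R
    = (n%:R + 1 - k%:R) * (n%:R - k%:R) / (k%:R + 1) ^+ 2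
      * (leg_coef n.+1 k)%:R :> rat.
Proof.
rewrite /leg_coef (_ : n + k.+1 = (n + k).+1)%N ?addSn; last lia.
rewrite !natrM rat_central_binS doubleS !rat_binSr.
rewrite -!natr1 natrD -muln2 natrM.
by field; rewrite !(natr1, =^~ natrM, =^~ natrD) !pnatr_eq0; lia.
Qed.

Definition coef_shift := (leg_coefSS, leg_coefSm, leg_coefmm).

(** * Recurrences for the generating polynomials *)

Definition shift_poly n : {poly rat} := \poly_(k < n.+1) (leg_coef n k)%:R.

Definition sqr_poly n : {poly rat} := \poly_(k < n.+1) (sqr_coef n k)%:R.

(** The numbers (n - k) a(n, k) 'C(2k, k) solve [cross_poly_rec], the relation
    that the recurrence imposes on n P_n P_(n-1) / x. *)
Definition cross_poly n : {poly rat} :=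
  \poly_(k < n.+1) ((n%:R - k%:R) * (sqr_coef n k)%:R).

(** Since a(n, k) = 0 for k > n, this holds for every k, and coefficient
    identities need no case distinction at the end of the range. *)
Lemma coef_shift_poly n k : (shift_poly n)`_k = (leg_coef n k)%:R.
Proof.
by rewrite coef_poly ltnS; case: leqP => // /leg_coef_small ->.
Qed.

Lemma coef_sqr_poly n k : (sqr_poly n)`_k = (sqr_coef n k)%:R.
Proof.
by rewrite coef_poly ltnS /sqr_coef; case: leqP => // /leg_coef_small ->.
Qed.

Lemma coef_cross_poly n k : (cross_poly n)`_k = (n%:R - k%:R) * (sqr_coef n k)%:R.
Proof.
rewrite coef_poly ltnS /sqr_coef; case: leqP => // /leg_coef_small ->.
by rewrite mulr0.
Qed.

Lemma coef_natmul n (q : {poly rat}) k : (n%:R * q)`_k = n%:R * q`_k.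
Proof. by rewrite -polyC_natr coefCM. Qed.

(** The three-term recurrence of the Legendre polynomials in the variable
    v = (x - 1) / 2, that is with x = 1 + 2 v. *)
Lemma shift_poly_rec n :
  n.+2%:R * shift_poly n.+2
    = (2 * n.+1 + 1)%:R * (shift_poly n.+1 + 2%:R * ('X * shift_poly n.+1))
      - n.+1%:R * shift_poly n.
Proof.
apply/polyP => -[|k];
  rewrite coefB !(coef_natmul, coefD) coefXM /= !coef_shift_poly.
  by rewrite !leg_coef0 !natrD !natrM -!natr1; ring.
rewrite !coef_shift !natrD !natrM -!natr1.
by field; rewrite !(natr1, =^~ natrM, =^~ natrD) !pnatr_eq0.
Qed.

(** The three-term recurrence multiplied by P_(n+1) and divided by x. *)
Lemma cross_poly_rec n :
  cross_poly n.+2 + cross_poly n.+1 = (2 * n.+1 + 1)%:R * sqr_poly n.+1.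
Proof.
apply/polyP => -[|k];
  rewrite !(coef_natmul, coefD) !coef_cross_poly !coef_sqr_poly /sqr_coef.
  by rewrite !leg_coef0 bin0 !natrD !natrM -!natr1; ring.
rewrite !(natrM _ (leg_coef _ _)) !coef_shift !natrD !natrM -!natr1.
by field; rewrite !(natr1, =^~ natrM, =^~ natrD) !pnatr_eq0.
Qed.

(** The square of the three-term recurrence, with x^2 = 1 + 4 u. *)
Lemma sqr_poly_rec n :
  let q := (2 * n.+1 + 1)%:R * sqr_poly n.+1 - 2%:R * cross_poly n.+1 in
  n.+2%:R * (n.+2%:R * sqr_poly n.+2)
    = (2 * n.+1 + 1)%:R * (q + 4%:R * ('X * q))
      + n.+1%:R * (n.+1%:R * sqr_poly n).
Proof.
move=> q; apply/polyP => -[|k].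
  rewrite /q !(coef_natmul, coefD, coefN, coefXM) /=.
  rewrite !coef_cross_poly !coef_sqr_poly /sqr_coef.
  by rewrite !leg_coef0 bin0 !natrD !natrM -!natr1; ring.
rewrite /q !(coef_natmul, coefD, coefN, coefXM) /=.
rewrite !coef_cross_poly !coef_sqr_poly /sqr_coef.
rewrite !(natrM _ (leg_coef _ _)) rat_central_binS !coef_shift.
rewrite !natrD !natrM -!natr1.
by field; rewrite !(natr1, =^~ natrM, =^~ natrD) !pnatr_eq0.
Qed.

Lemma legendre_rec n :
  n.+2%:R * legendre_poly n.+2
    = (2 * n.+1 + 1)%:R * ('X * legendre_poly n.+1)
      - n.+1%:R * legendre_poly n.
Proof.
have natE m (q : {poly rat}) : m%:R * q = m%:R *: q.
  by rewrite -polyC_natr mul_polyC.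
rewrite !natE [legendre_poly n.+2]/= scalerA divff ?scale1r //.
by rewrite pnatr_eq0.
Qed.

Lemma natr_polyI n : injective ( *%R (n.+1%:R : {poly rat})).
Proof. by apply: mulfI; rewrite -polyC_natr polyC_eq0 pnatr_eq0. Qed.

(** * Expansions of the Legendre polynomials and of their squares *)

Definition half_shift : {poly rat} := 2%:R^-1 *: ('X - 1).

Definition quarter_sqr : {poly rat} := 4%:R^-1 *: ('X ^+ 2 - 1).

Lemma half_shiftE : 2%:R * half_shift = 'X - 1.
Proof. by rewrite -polyC_natr mul_polyC scalerA divff ?scale1r. Qed.

Lemma quarter_sqrE : 4%:R * quarter_sqr = 'X ^+ 2 - 1.
Proof. by rewrite -polyC_natr mul_polyC scalerA divff ?scale1r. Qed.

Lemma comp_natmul n (q y : {poly rat}) : (n%:R * q) \Po y = n%:R * (q \Po y).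
Proof. by rewrite -polyC_natr comp_polyM comp_polyC. Qed.

Lemma comp_XM (q y : {poly rat}) : ('X * q) \Po y = y * (q \Po y).
Proof. by rewrite comp_polyM comp_polyX. Qed.

Definition compE := (comp_polyB, comp_polyD, comp_natmul, comp_XM).

Lemma legendre_shiftE n : legendre_poly n = shift_poly n \Po half_shift.
Proof.
suff: legendre_poly n = shift_poly n \Po half_shift
      /\ legendre_poly n.+1 = shift_poly n.+1 \Po half_shift by case.
elim: n => [|n [IH0 IH1]].
  split.
    have -> : shift_poly 0 = 1%:P.
      apply/polyP => -[|k]; rewrite coef_shift_poly coefC /= ?leg_coef0 //.
      by rewrite leg_coef_small.
    by rewrite comp_polyC.
  have -> : shift_poly 1 = 1%:P + 2%:R * 'X.
    apply/polyP => -[|[|k]];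
      rewrite coef_shift_poly coefD coef_natmul coefC coefX //=.
    by rewrite leg_coef_small // mulr0 addr0.
  by rewrite !compE comp_polyC comp_polyX half_shiftE polyC1 addrC subrK.
split=> //; apply: (@natr_polyI n.+1).
rewrite legendre_rec -comp_natmul shift_poly_rec !compE.
rewrite -IH0 -IH1.
have -> : 'X = 1 + 2%:R * half_shift by rewrite half_shiftE addrC subrK.
ring.
Qed.

(** Squares and products of consecutive polynomials are determined together: the
    square of the recurrence produces the cross term P_(n+1) P_n. *)
Lemma legendre_sqr n : legendre_poly n ^+ 2 = sqr_poly n \Po quarter_sqr.
Proof.
suff: [/\ legendre_poly n ^+ 2 = sqr_poly n \Po quarter_sqr,
          legendre_poly n.+1 ^+ 2 = sqr_poly n.+1 \Po quarter_sqr
        & n.+1%:R * (legendre_poly n.+1 * legendre_poly n)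
          = 'X * (cross_poly n.+1 \Po quarter_sqr)] by case.
elim: n => [|n [IH0 IH1 IHh]].
  split.
  - have -> : sqr_poly 0 = 1%:P.
      apply/polyP => -[|k]; rewrite coef_sqr_poly coefC //=.
      by rewrite /sqr_coef leg_coef_small.
    by rewrite comp_polyC expr1n.
  - have -> : sqr_poly 1 = 1%:P + 4%:R * 'X.
      apply/polyP => -[|[|k]];
        rewrite coef_sqr_poly coefD coef_natmul coefC coefX //=.
      by rewrite /sqr_coef leg_coef_small // mulr0 addr0.
    by rewrite !compE comp_polyC comp_polyX quarter_sqrE polyC1 addrC subrK.
  have -> : cross_poly 1 = 1%:P.
    apply/polyP => -[|[|k]]; rewrite coef_cross_poly coefC /sqr_coef //=.
    by rewrite leg_coef_small // mulr0.
  by rewrite comp_polyC mul1r.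
have sqrX : 'X ^+ 2 = 1 + 4%:R * quarter_sqr by rewrite quarter_sqrE addrC subrK.
split=> //; last first.
  have -> : cross_poly n.+2 = (2 * n.+1 + 1)%:R * sqr_poly n.+1 - cross_poly n.+1.
    by rewrite -cross_poly_rec addrK.
  rewrite mulrA legendre_rec !compE -IH1 mulrBr -IHh.
  ring.
apply: (@natr_polyI n.+1); apply: (@natr_polyI n.+1).
rewrite -2!comp_natmul sqr_poly_rec !compE -IH0 -IH1.
transitivity ((n.+2%:R * legendre_poly n.+2) ^+ 2); first by ring.
rewrite legendre_rec.
(* The cross term is isolated in the form given by the induction hypothesis; it
   carries a second factor x, so that only x^2 remains. *)
transitivity ('X ^+ 2 * ((2 * n.+1 + 1)%:R * legendre_poly n.+1) ^+ 2
  - 2%:R * (2 * n.+1 + 1)%:R * 'X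
     * (n.+1%:R * (legendre_poly n.+1 * legendre_poly n))
  + n.+1%:R ^+ 2 * legendre_poly n ^+ 2); first by ring.
rewrite IHh.
transitivity ('X ^+ 2 * (2 * n.+1 + 1)%:R *
  ((2 * n.+1 + 1)%:R * legendre_poly n.+1 ^+ 2
  - 2%:R * (cross_poly n.+1 \Po quarter_sqr))
  + n.+1%:R ^+ 2 * legendre_poly n ^+ 2); first by ring.
rewrite sqrX; ring.
Qed.

(** * The ring of polynomials over Z[1/2] and its congruences *)

Lemma Zhalf_int (m : int) : in_Zhalf m%:~R.
Proof. by exists 0, m; rewrite expr0 divr1. Qed.

Lemma Zhalf_add a b : in_Zhalf a -> in_Zhalf b -> in_Zhalf (a + b).
Proof.
move=> [i [m ->]] [j [n ->]]; exists (i + j)%N, (m * 2%:Z ^+ j + n * 2%:Z ^+ i).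
rewrite !rmorphD !rmorphM !rmorphXn /= exprD.
by field; rewrite !expf_eq0 /= !andbF.
Qed.

Lemma Zhalf_mul a b : in_Zhalf a -> in_Zhalf b -> in_Zhalf (a * b).
Proof.
move=> [i [m ->]] [j [n ->]]; exists (i + j)%N, (m * n).
rewrite rmorphM /= exprD.
by field; rewrite !expf_eq0 /= !andbF.
Qed.

Lemma poly_Zhalf_int (m : int) : poly_Zhalf m%:~R.
Proof.
move=> i; rewrite -[m%:~R](rmorph_int (@polyC rat)) coefC.
by case: ifP => _; [exact: Zhalf_int | exact: (Zhalf_int 0)].
Qed.

Lemma poly_ZhalfX : poly_Zhalf 'X.
Proof. by move=> i; rewrite coefX; apply: (Zhalf_int (i == 1%N)). Qed.

Lemma poly_ZhalfD f g : poly_Zhalf f -> poly_Zhalf g -> poly_Zhalf (f + g).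
Proof. by move=> Zf Zg i; rewrite coefD; apply: Zhalf_add. Qed.

Lemma poly_ZhalfM f g : poly_Zhalf f -> poly_Zhalf g -> poly_Zhalf (f * g).
Proof.
move=> Zf Zg i; rewrite coefM; apply: big_ind => [|a b|j _].
- exact: (Zhalf_int 0).
- exact: Zhalf_add.
- exact: Zhalf_mul.
Qed.

Lemma poly_ZhalfZ c f : in_Zhalf c -> poly_Zhalf f -> poly_Zhalf (c *: f).
Proof. by move=> Zc Zf i; rewrite coefZ; apply: Zhalf_mul. Qed.

Lemma poly_ZhalfXn f k : poly_Zhalf f -> poly_Zhalf (f ^+ k).
Proof.
move=> Zf; elim: k => [|k IH]; first exact: (poly_Zhalf_int 1).
by rewrite exprS; apply: poly_ZhalfM.
Qed.

Lemma Zhalf_inv2X k : in_Zhalf (2%:R ^+ k)^-1.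
Proof. by exists k, 1; rewrite mul1r. Qed.

Lemma poly_Zhalf_half_shift : poly_Zhalf half_shift.
Proof.
apply: poly_ZhalfZ; first exact: (Zhalf_inv2X 1).
by apply: (poly_ZhalfD poly_ZhalfX); apply: (poly_Zhalf_int (-1)).
Qed.

Lemma poly_Zhalf_quarter_sqr : poly_Zhalf quarter_sqr.
Proof.
apply: poly_ZhalfZ; first by rewrite (natrX _ 2 2); apply: (Zhalf_inv2X 2).
apply: (poly_ZhalfD (poly_ZhalfXn 2 poly_ZhalfX)).
exact: (poly_Zhalf_int (-1)).
Qed.

Section Congruence.

Variable p : nat.

Lemma poly_congr_refl f : poly_Zhalf f -> poly_congr p f f.
Proof.
by move=> Zf; split=> //; exists 0;
  [exact: (poly_Zhalf_int 0) | rewrite subrr scaler0].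
Qed.

Lemma poly_congr_trans f g h :
  poly_congr p f g -> poly_congr p g h -> poly_congr p f h.
Proof.
case=> Zf _ [u Zu fg] [_ Zh [v Zv gh]]; split=> //.
exists (u + v); first exact: poly_ZhalfD.
by rewrite scalerDr -fg -gh addrA subrK.
Qed.

Lemma poly_congrD f1 g1 f2 g2 :
  poly_congr p f1 g1 -> poly_congr p f2 g2 -> poly_congr p (f1 + f2) (g1 + g2).
Proof.
case=> Zf1 Zg1 [u Zu e1] [Zf2 Zg2 [v Zv e2]].
split; [exact: poly_ZhalfD | exact: poly_ZhalfD |].
exists (u + v); first exact: poly_ZhalfD.
by rewrite scalerDr -e1 -e2 opprD addrACA.
Qed.

Lemma poly_congrMr f g y :
  poly_congr p f g -> poly_Zhalf y -> poly_congr p (f * y) (g * y).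
Proof.
case=> Zf Zg [u Zu e] Zy; split; try exact: poly_ZhalfM.
by exists (u * y); [exact: poly_ZhalfM | rewrite -mulrBl e scalerAl].
Qed.

Lemma poly_congr_sum (I : Type) (r : seq I) (P : pred I) F G :
    (forall i, P i -> poly_congr p (F i) (G i)) ->
  poly_congr p (\sum_(i <- r | P i) F i) (\sum_(i <- r | P i) G i).
Proof.
move=> FG; apply: (big_ind2 (poly_congr p)) => // [|f1 g1 f2 g2].
  exact: poly_congr_refl (poly_Zhalf_int 0).
exact: poly_congrD.
Qed.

Hypothesis p_pr : prime p.

(** Equality in the field with p elements is how integers are compared from here
    on: signs and powers are handled there. *)
Lemma poly_congr_int (a b : int) :
  a%:~R = b%:~R :> 'F_p -> poly_congr p a%:~R b%:~R.
Proof.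
move=> ab; split; try exact: poly_Zhalf_int.
have /dvdzP[q def_ab] : (p %| a - b)%Z.
  by rewrite (dvdz_pcharf (pchar_Fp p_pr)) rmorphB /= ab subrr.
exists q%:~R; first exact: poly_Zhalf_int.
rewrite -rmorphB /= def_ab rmorphM /= mulrC -mul_polyC polyC_natr.
by congr (_ * _); rewrite -pmulrn.
Qed.

(** * Binomial coefficients modulo p *)

Lemma natr_Fp_eq0 n : (n%:R == 0 :> 'F_p) = (p %| n)%N.
Proof. by rewrite (dvdn_pcharf (pchar_Fp p_pr)). Qed.

Lemma prime_dvdn_fact n : (p %| n`!)%N = (p <= n)%N.
Proof.
elim: n => [|n IH].
  by rewrite dvdn1 leqn0; case: eqP p_pr => [->//|]; case: eqP => // ->.
rewrite factS Euclid_dvdM // IH.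
have [le_pn | lt_np] := leqP p n; first by rewrite orbT leqW.
rewrite orbF; apply/idP/idP => [/dvdn_leq-/(_ isT) //|].
by rewrite leq_eqVlt ltnS (leqNgt p n) lt_np orbF => /eqP->.
Qed.

(** p divides n! but neither m! nor (n - m)!. *)
Lemma prime_dvdn_bin n m :
  (m <= n)%N -> (m < p)%N -> (n - m < p)%N -> (p <= n)%N -> (p %| 'C(n, m))%N.
Proof.
move=> le_mn lt_mp lt_nmp le_pn.
have : (p %| 'C(n, m) * (m`! * (n - m)`!))%N.
  by rewrite bin_fact // prime_dvdn_fact.
rewrite Euclid_dvdM // => /orP[// |].
by rewrite Euclid_dvdM // !prime_dvdn_fact leqNgt lt_mp leqNgt lt_nmp.
Qed.

Lemma hockey_stick k n :
  (\sum_(r < n) 'C(r + k, k.*2))%N = 'C(n + k, k.*2.+1).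
Proof.
elim: n => [|n IH]; first by rewrite big_ord0 bin_small //; lia.
by rewrite big_ord_recr /= IH addSn binS.
Qed.

(** 'C(p, k+1) = 'C(p-1, k+1) + 'C(p-1, k) vanishes modulo p. *)
Lemma Fp_pred_bin k : (k < p)%N -> 'C(p.-1, k)%:R = (-1) ^+ k :> 'F_p.
Proof.
elim: k => [|k IH] lt_kp; first by rewrite bin0.
have : 'C(p, k.+1)%:R = 0 :> 'F_p.
  by apply/eqP; rewrite natr_Fp_eq0 prime_dvd_bin.
rewrite (_ : 'C(p, k.+1) = 'C(p.-1, k.+1) + 'C(p.-1, k))%N; last first.
  by rewrite -binS prednK ?prime_gt0.
rewrite natrD IH ?(ltnW lt_kp) //.
by rewrite exprS mulN1r => /eqP; rewrite addr_eq0 => /eqP.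
Qed.

(** In 'C(p+k+1, p) = 'C(p+k, p) + 'C(p+k, p-1) the last term vanishes modulo p,
    because (k+1) 'C(p+k, p-1) = p 'C(p+k, p) and k+1 < p. *)
Lemma Fp_addp_bin k : (k < p)%N -> 'C(p + k, p)%:R = 1 :> 'F_p.
Proof.
elim: k => [|k IH] lt_kp; first by rewrite addn0 binn.
have -> : 'C(p + k.+1, p) = ('C(p + k, p) + 'C(p + k, p.-1))%N.
  by case: (p) (prime_gt0 p_pr) => // q _; rewrite addnS binS.
rewrite natrD IH ?(ltnW lt_kp) //; suff -> : 'C(p + k, p.-1)%:R = 0 :> 'F_p.
  by rewrite addr0.
have e := mul_bin_left (p + k) p.-1; rewrite prednK ?prime_gt0 // in e.
have : (p %| (p + k - p.-1) * 'C(p + k, p.-1))%N by rewrite -e dvdn_mulr.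
rewrite (_ : p + k - p.-1 = k.+1)%N; last by have := prime_gt0 p_pr; lia.
by rewrite Euclid_dvdM // gtnNdvd //= -natr_Fp_eq0 => /eqP.
Qed.

Hypothesis p_odd : odd p.

Let h := (p.-1)./2.

Let defp : p = h.*2.+1.
Proof. by rewrite /h; have := prime_gt0 p_pr; lia. Qed.

Let p1E : p.-1 = (2 * h)%N.
Proof. by rewrite [in LHS]defp mul2n. Qed.

(** For k < h the numbers 2k+1 and p-k-1 are both less than p, so p divides
    'C(p+k, 2k+1); for h < k < p it divides 'C(2k, k), since k < p <= 2k. *)
Lemma Fp_leg_coef_sum k : (k < p)%N ->
  (\sum_(r < p) leg_coef r k)%:R = (-1) ^+ h *+ (k == h) :> 'F_p.
Proof.
move=> lt_kp; rewrite -big_distrl /= hockey_stick natrM.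
have [-> | k_neq_h] := eqVneq k h.
  rewrite -defp Fp_addp_bin ?mul1r; last by rewrite defp; lia.
  by rewrite {1}(_ : h.*2 = p.-1) ?Fp_pred_bin // defp; lia.
apply/eqP; rewrite mulr0n mulf_eq0 !natr_Fp_eq0.
have [lt_kh | gt_kh | e] := ltngtP k h; last by rewrite e eqxx in k_neq_h.
  by rewrite prime_dvdn_bin //; lia.
by rewrite (@prime_dvdn_bin k.*2) ?orbT //; lia.
Qed.

(** The weight w is 1 for the sum of the P_r and 'C(2k, k) for the sum of their
    squares. *)
Lemma poly_congr_leg_coef_sum (w : nat -> nat) (y : {poly rat}) :
    poly_Zhalf y ->
  poly_congr p
    (\sum_(r < p) (\poly_(k < r.+1) (leg_coef r k * w k)%:R \Po y))
    (((-1) ^+ h * (w h)%:Z)%:~R * y ^+ h).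
Proof.
move=> Zy.
(* The summation over k is extended to k < p, a range independent of r. *)
have -> : \sum_(r < p) (\poly_(k < r.+1) (leg_coef r k * w k)%:R \Po y)
    = \sum_(k < p) (Posz ((\sum_(r < p) leg_coef r k) * w k))%:~R * y ^+ k.
  under [RHS]eq_bigr do rewrite -pmulrn big_distrl natr_sum big_distrl /=.
  rewrite exchange_big; apply: eq_bigr => r _ /=.
  rewrite (_ : \poly_(k < r.+1) _ = \poly_(k < p) (leg_coef r k * w k)%:R).
    rewrite poly_def raddf_sum; apply: eq_bigr => k _ /=.
    by rewrite comp_polyZ rmorphXn /= comp_polyX -mul_polyC polyC_natr.
  apply/polyP => k; rewrite !coef_poly ltnS.
  have [le_kr | /leg_coef_small ->] := leqP k r; last by rewrite mul0n if_same.
  by rewrite (leq_ltn_trans le_kr (ltn_ord r)).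
have lt_hp : (h < p)%N by rewrite defp; lia.
have -> : ((-1) ^+ h * (w h)%:Z)%:~R * y ^+ h
    = \sum_(k < p) (((-1) ^+ h *+ (k == h :> nat) : int) * (w k)%:Z)%:~R * y ^+ k.
  rewrite (bigD1 (Ordinal lt_hp)) //= eqxx big1 ?addr0 // => k.
  by rewrite -val_eqE /= => /negPf ->; rewrite mulr0n !mul0r.
apply: poly_congr_sum => k _; apply: poly_congrMr; last exact: poly_ZhalfXn.
apply: poly_congr_int.
rewrite -pmulrn natrM Fp_leg_coef_sum // rmorphM /= rmorphMn rmorphXn /=.
by rewrite rmorphN rmorph1 -pmulrn.
Qed.

(** * Euler's criterion *)

Lemma Fp_fermat (x : 'F_p) : x != 0 -> x ^+ p.-1 = 1.
Proof.
move=> x0; apply: (mulfI x0); rewrite mulr1 -exprS prednK ?prime_gt0 //.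
by rewrite -{2}[x]expf_card card_Fp.
Qed.

(** For b nonzero, b^h is a square root of 1.  If it is 1, write b = z^i with z
    a primitive root: 2h divides i h, so i is even and b is a square. *)
Lemma Fp_euler_criterion (a : int) :
  (legendre_symbol a p)%:~R = a%:~R ^+ h :> 'F_p.
Proof.
rewrite /legendre_symbol; set b : 'F_p := a%:~R.
have h_gt0 : (0 < h)%N by have := prime_gt1 p_pr; lia.
case: eqVneq => [-> | b0]; first by rewrite expr0n gtn_eqF.
case: existsP => [[x /eqP def_b] | no_sqrt].
  rewrite -def_b -exprM -p1E Fp_fermat //.
  by apply: contraNneq b0 => x0; rewrite -def_b x0 expr0n.
have /eqP : (b ^+ h) ^+ 2 = 1 by rewrite -exprM mulnC -p1E Fp_fermat.
rewrite sqrf_eq1 => /orP[/eqP bh1 | /eqP -> //]; case: no_sqrt.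
have /hasP[z _ prim_z] : has p.-1.-primitive_root (enum [pred x : 'F_p | x != 0]).
  apply: has_prim_root; rewrite ?enum_uniq //.
  - by rewrite p1E; lia.
  - apply/allP => x; rewrite mem_enum inE => x0.
    by apply/unity_rootP; apply: Fp_fermat.
  by rewrite -cardE cardC1 card_Fp.
have [[i _] /= def_b] := prim_rootP prim_z (Fp_fermat b0).
move: bh1; rewrite def_b -exprM => /eqP.
rewrite -(prim_order_dvd prim_z) p1E dvdn_pmul2r // => i_even.
by exists (z ^+ (i %/ 2)); rewrite -exprM divnK.
Qed.

Lemma Fp_two_neq0 : 2%:R != 0 :> 'F_p.
Proof. by rewrite natr_Fp_eq0 gtnNdvd //; have := prime_gt1 p_pr; lia. Qed.

Lemma Fp_4X : 4%:R ^+ h = 1 :> 'F_p.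
Proof.
by rewrite (natrX _ 2 2) -exprM -p1E (Fp_fermat Fp_two_neq0).
Qed.

(** * The two congruences *)

Lemma legendre_sum_congr :
  poly_congr p (\sum_(r < p) legendre_poly r)
    ((legendre_symbol (-2) p)%:~R * ('X - 1) ^+ h).
Proof.
have shift_poly1 r : shift_poly r = \poly_(k < r.+1) (leg_coef r k * 1)%:R.
  by apply: eq_poly => k _; rewrite muln1.
under eq_bigr do rewrite legendre_shiftE shift_poly1.
have := poly_congr_leg_coef_sum (fun=> 1%N) poly_Zhalf_half_shift.
move/poly_congr_trans; apply.
rewrite -half_shiftE exprMn -natrX mulrA.
rewrite [(2 ^ h)%:R]pmulrn -intrM.
apply: poly_congrMr; last exact: poly_ZhalfXn poly_Zhalf_half_shift.
apply: poly_congr_int; rewrite mulr1 [in RHS]rmorphM /= Fp_euler_criterion.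
rewrite -pmulrn natrX -exprMn rmorphXn /= rmorphN rmorph1.
(* (x - 1)^h = 2^h v^h, so (-2)^h has to be multiplied by 2^h. *)
have -> : (-2)%:~R * 2%:R = -1 * 4%:R :> 'F_p.
  by rewrite rmorphN /= mulN1r mulNr -natrM.
by rewrite exprMn Fp_4X mulr1.
Qed.

Lemma legendre_sqr_sum_congr :
  poly_congr p (\sum_(r < p) legendre_poly r ^+ 2) (('X ^+ 2 - 1) ^+ h).
Proof.
under eq_bigr do rewrite legendre_sqr.
have := poly_congr_leg_coef_sum (fun k => 'C(k.*2, k)) poly_Zhalf_quarter_sqr.
move/poly_congr_trans; apply.
rewrite -quarter_sqrE exprMn -natrX pmulrn.
apply: poly_congrMr; last exact: poly_ZhalfXn poly_Zhalf_quarter_sqr.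
apply: poly_congr_int; rewrite -pmulrn natrX Fp_4X.
rewrite rmorphM rmorphXn /= rmorphN rmorph1 -pmulrn.
rewrite (_ : h.*2 = p.-1) ?Fp_pred_bin; [|by rewrite defp; lia|by rewrite defp].
by rewrite -exprMn mulrNN mulr1 expr1n.
Qed.

End Congruence.

Theorem lemma6p1 (p : nat) (hp : prime p) (hodd : odd p) :
  poly_congr p (\sum_(0 <= r < p) legendre_poly r)
    ((legendre_symbol (-2) p)%:~R *: ('X - 1) ^+ (p.-1)./2)
  /\
  poly_congr p (\sum_(0 <= r < p) legendre_poly r ^+ 2)
    (('X ^+ 2 - 1) ^+ (p.-1)./2).
Proof.
rewrite !big_mkord; split; last exact: legendre_sqr_sum_congr.
rewrite -mul_polyC (rmorph_int (@polyC rat)).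
exact: legendre_sum_congr.
Qed.
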